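(* A finite vector configuration $B=\{b_1,\ldots,b_n\}\subseteq\mathbb{Z}^m$ is supernormal if and only if for every $c\in\mathbb{Z}^n$ for which the inequality system $b_i\cdot x\le c_i$ ($i=1,\ldots,n$) is tight, this system is totally dual integral.
   Context: $\mathrm{cone}(C)$ is the set of non-negative real combinations of a finite set $C$. $B$ is supernormal if for every subset $B'\subseteq B$, every point of $\mathrm{cone}(B')\cap\mathbb{Z}^m$ is a non-negative integer combination of $B\cap\mathrm{cone}(B')$. For $c\in\mathbb{Z}^n$ let $P_c=\{x\in\mathbb{R}^m : b_i\cdot x\le c_i,\ i=1,\ldots,n\}$. The system $b_i\cdot x\le c_i$ ($i=1,\ldots,n$) is tight if $P_{c-e_i}\cap\mathbb{Z}^m$ is strictly contained in $P_c\cap\mathbb{Z}^m$ for every unit vector $e_i\in\mathbb{Z}^n$ (equivalently, for each $i$ there is a lattice point $x\in P_c$ with $b_i\cdot x=c_i$). The system is totally dual integral (TDI) if for every $w\in\mathbb{Z}^m$ such that $\max\{w\cdot x : x\in P_c\}$ is finite, the dual linear program $\min\{\sum_i y_ic_i : y\in\mathbb{R}^n,\ y\ge0,\ \sum_i y_ib_i=w\}$ has an integral optimal solution. *)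

(* Defs.v *)
From HB Require Import structures.
From mathcomp Require Import all_boot all_order all_algebra.
From mathcomp Require Import boolp classical_sets reals.

Import Order.TTheory GRing.Theory Num.Theory.
Local Open Scope classical_set_scope.
Local Open Scope ring_scope.

(* A configuration b_1, ..., b_n of vectors of Z^m is given by the matrix B
   whose i-th row is b_i (repetitions are allowed), so that (B *m x) i 0 is the
   dot product of b_i and x.  Subsets of the
   configuration are given by sets of row indices.  Primal points and right-hand
   sides are columns; the b_i, the objective w and the dual points are rows. *)

Definition toR (R : realType) {p q : nat} (A : 'M[int]_(p, q)) : 'M[R]_(p, q) :=
  map_mx intr A.

Definition cone (R : realType) {m n : nat} (B : 'M[int]_(n, m)) (I : {set 'I_n}) :
    set 'rV[R]_m :=
  [set x : 'rV[R]_m | exists a : 'I_n -> R,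
     (forall i, i \in I -> 0 <= a i) /\
     x = \sum_(i in I) a i *: toR R (row i B)].

Definition supernormal (R : realType) {m n : nat} (B : 'M[int]_(n, m)) : Prop :=
  forall (I : {set 'I_n}) (v : 'rV[int]_m),
    cone R B I (toR R v) ->
    exists k : 'I_n -> nat,
      v = \sum_(j | `[< cone R B I (toR R (row j B)) >]) row j B *+ k j.

Definition polyhedron (R : realType) {m n : nat} (B : 'M[int]_(n, m))
    (c : 'cV[int]_n) : set 'cV[R]_m :=
  [set x : 'cV[R]_m | forall i, (toR R B *m x) i 0 <= toR R c i 0].

Definition lattice_points (R : realType) {m n : nat} (B : 'M[int]_(n, m))
    (c : 'cV[int]_n) : set 'cV[int]_m :=
  [set x : 'cV[int]_m | polyhedron R B c (toR R x)].

Definition tight (R : realType) {m n : nat} (B : 'M[int]_(n, m))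
    (c : 'cV[int]_n) : Prop :=
  forall i : 'I_n,
    lattice_points R B (c - delta_mx i 0) `<` lattice_points R B c.

Definition primal_values (R : realType) {m n : nat} (B : 'M[int]_(n, m))
    (c : 'cV[int]_n) (w : 'rV[int]_m) : set R :=
  [set (toR R w *m x) 0 0 | x in polyhedron R B c].

Definition dual_feasible (R : realType) {m n : nat} (B : 'M[int]_(n, m))
    (w : 'rV[int]_m) : set 'rV[R]_n :=
  [set y : 'rV[R]_n | (forall i, 0 <= y 0 i) /\ y *m toR R B = toR R w].

Definition dual_optimal (R : realType) {m n : nat} (B : 'M[int]_(n, m))
    (c : 'cV[int]_n) (w : 'rV[int]_m) : set 'rV[R]_n :=
  [set y : 'rV[R]_n | dual_feasible R B w y /\
     forall y', dual_feasible R B w y' ->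
       (y *m toR R c) 0 0 <= (y' *m toR R c) 0 0].

(* The maximum of the primal is finite when some primal value is an upper bound
   of all of them; in particular this excludes an infeasible primal. *)
Definition TDI (R : realType) {m n : nat} (B : 'M[int]_(n, m))
    (c : 'cV[int]_n) : Prop :=
  forall w : 'rV[int]_m,
    primal_values R B c w `&` ubound (primal_values R B c w) !=set0 ->
    exists y : 'rV[int]_n, dual_optimal R B c w (toR R y).

(* Main.v *)
(** Both directions rest on Farkas' lemma with integral separating vectors.

    If [B] is supernormal, [c] is tight and [x] maximizes [w] over [P_c], then
    [w] lies in the cone of the rows active at [x], so it is a nonnegative
    integer combination of the rows [b_j] in that cone.  Each such [b_j] is
    also maximized at [x], and tightness forces this maximum to be [c_j]: only
    active rows are used, so the combination is dual optimal.

    Conversely, let [v] be a lattice point of the cone of the rows in [I], and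
    let [J] be the set of all rows in that cone.  For [j] outside [J] pick an
    integral [z_j] with [b_i z_j <= 0] on [I] and [b_j z_j > 0], and let [c_k]
    be the maximum of [b_k] over [0] and all the [z_j].  This [c] is tight,
    zero on [J] and positive off [J].  As [0] maximizes [v] over [P_c], an
    integral dual optimal solution is supported on [J] and has sum [v]. *)

Require Import Defs.
From mathcomp Require Import all_boot all_order all_algebra.
From mathcomp Require Import boolp classical_sets reals.

Import Order.TTheory GRing.Theory Num.Theory.
Local Open Scope classical_set_scope.
Local Open Scope ring_scope.

(* Bartl's induction on the number of rows, kept division-free so that it
   applies to [int] and yields integral separating vectors. *)
Lemma farkas (D : realDomainType) (m n : nat) (A : 'M[D]_(n, m)) (b : 'rV[D]_m) :
  (exists d : D, exists y : 'rV[D]_n,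
     [/\ 0 < d, forall i, 0 <= y 0 i & d *: b = y *m A]) \/
  (exists z : 'cV[D]_m, (forall i, (A *m z) i 0 <= 0) /\ 0 < (b *m z) 0 0).
Proof.
elim: n A b => [|n IHn] A b.
  have [->|b0] := eqVneq b 0.
    left; exists 1, 0; split; [exact: ltr01 | by case | ].
    by rewrite scaler0 mul0mx.
  right; exists b^T; split; first by case.
  have sqb i : true -> 0 <= b 0 i * b^T i 0 by rewrite mxE -expr2 sqr_ge0.
  rewrite mxE lt_def sumr_ge0 // andbT psumr_eq0 //.
  apply: contra b0 => /allP bE; apply/eqP/rowP => i; rewrite mxE.
  by have := bE i (mem_index_enum i); rewrite /= mxE -expr2 sqrf_eq0 => /eqP.
pose A1 : 'M[D]_(1 + n, m) := A.
pose a := usubmx A1; pose Ad := dsubmx A1.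
have AE : A = col_mx a Ad :> 'M_(1 + n, m) by rewrite vsubmxK.
rewrite -[n.+1]/(1 + n)%N in A A1 a Ad AE *; rewrite AE.
have col_le0 (z : 'cV[D]_m) : (a *m z) 0 0 <= 0 -> (forall i, (Ad *m z) i 0 <= 0) ->
    forall i, (col_mx a Ad *m z) i 0 <= 0.
  move=> az Az i; rewrite mul_col_mx mxE; case: splitP => j _ //.
  by rewrite ord1.
have [[d [y [d0 y0 dE]]]|[x [Ax bx]]] := IHn Ad b.
  left; exists d, (row_mx 0 y); split=> //; last by rewrite mul_row_col mul0mx add0r.
  by move=> i; rewrite mxE; case: splitP => j _ //; rewrite mxE.
have [t_le0|t_gt0] := leP ((a *m x) 0 0) 0.
  by right; exists x; split=> //; exact: col_le0.
set t := (a *m x) 0 0 in t_gt0.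
have axE : a *m x = t%:M by rewrite -mx11_scalar.
(* The map [t *: z - x *m (a *m z)] is [t] times the projection along [x] onto the kernel of [a].
   The induction hypothesis is applied to [Ad] and [b] composed with it. *)
have [[d [y [d0 y0 dE]]]|[z [Az bz]]] :=
    IHn (t *: Ad - (Ad *m x) *m a) (t *: b - (b *m x) *m a).
(* Solving for [b] leaves [a] with the coefficient [d (b x) - y (Ad x)], nonnegative because
   [b x > 0] and [Ad x <= 0]. *)
- left; exists (d * t), (row_mx (d *: (b *m x) - y *m (Ad *m x)) (t *: y)); split.
  + exact: mulr_gt0.
  + move=> i; rewrite mxE; case: splitP => j _; last by rewrite mxE mulr_ge0 // ltW.
    rewrite ord1 !mxE subr_ge0; apply: (@le_trans _ _ 0).
      rewrite -oppr_ge0 -sumrN sumr_ge0 // => k _.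
      by rewrite -mulrN mulr_ge0 // oppr_ge0; exact: Ax.
    by rewrite mulr_ge0 // ltW //; move: bx; rewrite mxE.
  + rewrite mul_row_col mulmxBl -scalemxAl -scalemxAl.
    move: dE; rewrite scalerBr scalerA mulmxBr -scalemxAr mulmxA.
    move=> /eqP; rewrite subr_eq => /eqP ->.
    by rewrite !mulmxA [RHS]addrC -addrA [- _ + _]addrC.
- right; exists (t *: z - x *m (a *m z)); split.
    apply: col_le0 => [|i].
      by rewrite mulmxBr !mulmxA axE -scalemxAr mul_scalar_mx -scalemxAl subrr mxE.
    have -> : Ad *m (t *: z - x *m (a *m z)) = (t *: Ad - (Ad *m x) *m a) *m z.
      by rewrite mulmxBr mulmxBl -scalemxAr -scalemxAl !mulmxA.
    exact: Az.
  have -> : b *m (t *: z - x *m (a *m z)) = (t *: b - (b *m x) *m a) *m z.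
    by rewrite mulmxBr mulmxBl -scalemxAr -scalemxAl !mulmxA.
  exact: bz.
Qed.

(** A ratio test: with slacks [s] and rates [t], a step of length [e] breaks no constraint that has
    positive slack. *)
Lemma small_step (R : realFieldType) (n : nat) (s t : 'I_n -> R) :
  exists2 e : R, 0 < e & forall i, 0 < s i -> e * t i <= s i.
Proof.
pose u i := s i / (1 + `|t i|).
have den_gt0 i : 0 < 1 + `|t i| by rewrite ltr_pwDl.
exists (\big[Num.min/1]_(i | 0 < s i) u i).
  by apply: lt_bigmin => // i si; exact: divr_gt0.
move=> i si; set e := \big[_/_]_(_ | _) _.
have e_gt0 : 0 < e by apply: lt_bigmin => // j sj; exact: divr_gt0.
have : e <= u i by exact: bigmin_le_cond.
rewrite ler_pdivlMr // => le_e; apply: le_trans le_e.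
by rewrite ler_pM2l // (le_trans (ler_norm _)) // lerDr.
Qed.

Section IntegralSystem.
Set Implicit Arguments.
Unset Strict Implicit.
Variables (R : realType) (m n : nat).
Implicit Types (B : 'M[int]_(n, m)) (c : 'cV[int]_n) (I : {set 'I_n}).

Lemma toRE (p q : nat) (A : 'M[int]_(p, q)) i j : toR R A i j = (A i j)%:~R.
Proof. by rewrite mxE. Qed.

Lemma toR_mul (p q r : nat) (A : 'M[int]_(p, q)) (C : 'M[int]_(q, r)) i j :
  (toR R A *m toR R C) i j = ((A *m C) i j)%:~R.
Proof. by rewrite -map_mxM mxE. Qed.

Lemma lattice_pointsP B c x :
  lattice_points R B c x <-> forall i, (B *m x) i 0 <= c i 0.
Proof.
split=> xP i.
  by have := xP i; rewrite toR_mul toRE ler_int.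
by rewrite toR_mul toRE ler_int.
Qed.

(** By integrality, a lattice point of [P_c] violating [b_j x <= c_j - 1] has [b_j x = c_j]. *)
Lemma tightP B c :
  tight R B c <->
  forall j, exists2 x, lattice_points R B c x & (B *m x) j 0 = c j 0.
Proof.
split=> [cP j|cP j].
  have [_ /existsNP[x /not_implyP[xc xNc]]] := cP j.
  exists x => //; move/lattice_pointsP in xc.
  apply/eqP; rewrite eq_le xc /= leNgt; apply/negP => ltx; apply: xNc.
  apply/lattice_pointsP => i; rewrite !mxE eqxx andbT.
  have [->|_] := eqVneq i j; last by have := xc i; rewrite mxE /= subr0.
  by move: ltx; rewrite mxE /= -lezD1 -lerBrDr.
split=> [x /lattice_pointsP xc|].
  apply/lattice_pointsP => i; apply: le_trans (xc i) _.
  by rewrite !mxE gerBl; case: (_ && _).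
have [x xc xj] := cP j => /(_ x xc) /lattice_pointsP /(_ j).
by rewrite xj !mxE !eqxx lerBrDl gerDr.
Qed.

Lemma mul_sum_rows B (I : {pred 'I_n}) (a : 'I_n -> R) (x : 'cV[R]_m) :
  ((\sum_(i in I) a i *: toR R (row i B)) *m x) 0 0 =
  \sum_(i in I) a i * (toR R B *m x) i 0.
Proof.
rewrite mulmx_suml summxE; apply: eq_bigr => i _.
by rewrite -scalemxAl mxE /toR map_row -row_mul [row _ _ _ _]mxE.
Qed.

Lemma row_mul_entry B (x : 'cV[R]_m) j :
  (toR R (row j B) *m x) 0 0 = (toR R B *m x) j 0.
Proof. by rewrite /toR map_row -row_mul mxE. Qed.

Lemma cone_row B I i : i \in I -> cone R B I (toR R (row i B)).
Proof.
move=> iI; exists (fun k => (k == i)%:R); split=> [k _|]; first exact: ler0n.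
rewrite (bigD1 i) //= eqxx scale1r big1 ?addr0 // => k /andP[_ /negPf ->].
by rewrite scale0r.
Qed.

Lemma cone_or_separated B I (w : 'rV[int]_m) :
  cone R B I (toR R w) \/
  exists z : 'cV[int]_m,
    (forall i, i \in I -> (B *m z) i 0 <= 0) /\ 0 < (w *m z) 0 0.
Proof.
(* Zero rows outside [I] constrain no [z] and add nothing to a combination, so [farkas] applies
   without reindexing. *)
pose A := \matrix_(i, j) (if i \in I then B i j else 0).
have [[d [y [d0 y0 dE]]]|[z [Az wz]]] := farkas _ _ _ A w; [left|right].
  have dR : d%:~R != 0 :> R by rewrite intr_eq0 gt_eqF.
  exists (fun i => (y 0 i)%:~R / d%:~R); split=> [i _|].
    by rewrite divr_ge0 // ler0z // ltW.
  apply/rowP => j; apply: (mulfI dR).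
  move/rowP/(_ j): dE; rewrite !mxE summxE -intrM => ->.
  rewrite mulr_sumr [in RHS]big_mkcond /= rmorph_sum; apply: eq_bigr => i _.
  rewrite !mxE; case: ifP => _; last by rewrite mulr0.
  by rewrite rmorphM /= mulrA mulrCA mulfV // mulr1.
exists z; split=> // i iI; have := Az i; rewrite !mxE.
by under eq_bigr do rewrite mxE iI.
Qed.

Lemma weak_duality B c (w : 'rV[int]_m) (x : 'cV[R]_m) (y : 'rV[R]_n) :
  polyhedron R B c x -> dual_feasible R B w y ->
  (toR R w *m x) 0 0 <= (y *m toR R c) 0 0.
Proof.
move=> xP [y0 <-]; rewrite -mulmxA mxE [leRHS]mxE.
by apply: ler_sum => i _; rewrite ler_wpM2l.
Qed.

(** Otherwise a separating [z] increases [w] without increasing any active row, and a short step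
    along it stays feasible, against maximality. *)
Lemma optimal_in_active_cone B c (w : 'rV[int]_m) (x : 'cV[R]_m) :
  polyhedron R B c x ->
  ubound (primal_values R B c w) ((toR R w *m x) 0 0) ->
  cone R B [set i | (toR R B *m x) i 0 == toR R c i 0] (toR R w).
Proof.
move=> xP xmax; set I := (X in cone R B X).
have [//|[z [Bz wz]]] := cone_or_separated B I w.
have [e e0 eP] := small_step _ _ (fun i => toR R c i 0 - (toR R B *m x) i 0)
  (fun i => (toR R B *m toR R z) i 0).
have : (toR R w *m (x + e *: toR R z)) 0 0 <= (toR R w *m x) 0 0.
  apply: xmax; exists (x + e *: toR R z) => // i.
  rewrite mulmxDr -scalemxAr mxE [X in _ + X]mxE -lerBrDl.
  have [iI|iNI] := boolP (i \in I).
    have := iI; rewrite inE => /eqP ->; rewrite subrr.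
    by rewrite pmulr_rle0 // toR_mul lerz0 Bz.
  apply: eP; rewrite subr_gt0 lt_neqAle xP andbT.
  by move: iNI; rewrite inE.
rewrite mulmxDr -scalemxAr mxE gerDl mxE pmulr_rle0 // toR_mul lerz0.
by rewrite leNgt wz.
Qed.

(** A lattice point [z] with [b_j z = c_j] has [b_i z <= c_i = b_i x] on [I]; combining these with
    nonnegative coefficients gives [c_j <= b_j x]. *)
Lemma tight_cone_active B c I (x : 'cV[R]_m) j :
  tight R B c -> polyhedron R B c x ->
  (forall i, i \in I -> (toR R B *m x) i 0 = toR R c i 0) ->
  cone R B I (toR R (row j B)) -> (toR R B *m x) j 0 = toR R c j 0.
Proof.
move=> /tightP/(_ j)[z zc zj] xP xI [a [a0 aE]].
apply/eqP; rewrite eq_le xP /= [leLHS]mxE -zj -toR_mul -!row_mul_entry aE.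
rewrite !mul_sum_rows; apply: ler_sum => i iI.
by rewrite ler_wpM2l ?a0 // xI //; exact: zc.
Qed.

Lemma supernormal_tight_TDI B c :
  supernormal R B -> tight R B c -> TDI R B c.
Proof.
move=> Bsn ct w [_ [[x xP <-] xmax]].
pose I := [set i | (toR R B *m x) i 0 == toR R c i 0]%SET.
have [k wE] := Bsn I w (optimal_in_active_cone xP xmax).
pose J j := `[< cone R B I (toR R (row j B)) >].
pose y : 'rV[int]_n := \row_j (if J j then (k j)%:Z else 0).
have xJ j : J j -> (toR R B *m x) j 0 = toR R c j 0.
  move=> /asboolP; apply: tight_cone_active => // i.
  by rewrite inE => /eqP.
have yw : y *m B = w.
  rewrite mulmx_sum_row wE [RHS]big_mkcond; apply: eq_bigr => j _.
  rewrite mxE -/(J j); case: (J j); last by rewrite scale0r.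
  by rewrite -scaler_nat natz.
exists y; split.
  split=> [j|]; first by rewrite !mxE ler0z; case: ifP.
  by rewrite -map_mxM yw.
(* It remains to see that [y c = w x], by complementary slackness: [y] is supported on rows active
   at [x]. *)
move=> y' y'P; apply: le_trans (weak_duality xP y'P).
rewrite -yw /toR map_mxM -mulmxA mxE [leRHS]mxE le_eqVlt; apply/orP; left.
apply/eqP/eq_bigr => j _; rewrite [map_mx _ y _ _]mxE [y _ _]mxE.
by case: ifP => [/xJ ->//|_]; rewrite !mul0r.
Qed.

Lemma exists_tight_vanishing_on_cone B I :
  exists2 c : 'cV[int]_n, tight R B c &
    forall j, 0 <= c j 0 /\ (c j 0 = 0 <-> cone R B I (toR R (row j B))).
Proof.
have zP j : exists z : 'cV[int]_m,
    (forall i, i \in I -> (B *m z) i 0 <= 0) /\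
    (~ cone R B I (toR R (row j B)) -> 0 < (B *m z) j 0).
  have [jI|[z [zI zj]]] := cone_or_separated B I (row j B).
    by exists 0; split=> // i _; rewrite mulmx0 mxE.
  by exists z; split=> // _; move: zj; rewrite -row_mul mxE.
have [z {}zP] := choice zP.
(* [None] stands for the origin, where every row takes the default value 0 of the maximum; hence
   each maximum is attained at some [pt o]. *)
pose pt (o : option 'I_n) := if o is Some j then z j else 0.
pose c : 'cV[int]_n := \col_k \big[Num.max/0]_(o : option 'I_n) (B *m pt o) k 0.
have ptc o : lattice_points R B c (pt o).
  by apply/lattice_pointsP => k; rewrite [leRHS]mxE; exact: (le_bigmax _ (fun o => (B *m pt o) k 0)).
have c_ge0 k : 0 <= c k 0 by rewrite mxE bigmax_ge_id.
exists c => [|j].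
  apply/tightP => j.
  have [o oE] : exists o, c j 0 = (B *m pt o) j 0.
    rewrite mxE; elim/big_ind: _ => [|_ _ [o ->] [o' ->]|o _]; last by exists o.
      by exists None; rewrite mulmx0 mxE.
    by case: leP; [exists o' | exists o].
  by exists (pt o).
split=> //; split=> [cj0|[a [a0 aE]]].
  apply: contrapT => /(proj2 (zP j)); apply/negP; rewrite -leNgt -cj0.
  by have /lattice_pointsP := ptc (Some j).
apply/eqP; rewrite eq_le c_ge0 andbT mxE; apply/bigmax_leP; split=> // o _.
rewrite -(ler_int R) -toR_mul -row_mul_entry aE mul_sum_rows.
rewrite -oppr_ge0 -sumrN sumr_ge0 // => i iI.
rewrite -mulrN mulr_ge0 ?a0 // oppr_ge0 toR_mul lerz0.
case: o => [k|] /=; first exact: (proj1 (zP k)).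
by rewrite mulmx0 mxE.
Qed.

Lemma tight_TDI_supernormal B :
  (forall c, tight R B c -> TDI R B c) -> supernormal R B.
Proof.
move=> BTDI I v [a [a0 aE]].
have [c ct cP] := exists_tight_vanishing_on_cone B I.
have cI i : i \in I -> c i 0 = 0.
  by move=> iI; apply/(proj2 (cP i)); exact: cone_row.
have [|y [[y0 yv] ymin]] := BTDI c ct v.
  (* The origin is feasible since [c] is nonnegative, and [v x <= 0] on [P_c] since [c] vanishes on
     [I]. *)
  exists 0; split.
    exists 0; last by rewrite mulmx0 mxE.
    by move=> i; rewrite mulmx0 !mxE ler0z; case: (cP i).
  move=> _ [x xP <-]; rewrite aE mul_sum_rows -oppr_ge0 -sumrN sumr_ge0 // => i iI.
  rewrite -mulrN mulr_ge0 ?a0 // oppr_ge0 (le_trans (xP i)) //.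
  by rewrite mxE cI.
have y_ge0 i : 0 <= y 0 i by have := y0 i; rewrite toRE ler0z.
(* The real cone coefficients [a] give a dual feasible point of value 0. *)
have yc0 : (y *m c) 0 0 <= 0.
  have : dual_feasible R B v (\row_i (if i \in I then a i else 0)).
    split=> [i|]; first by rewrite mxE; case: ifP => // /a0.
    rewrite aE mulmx_sum_row [RHS]big_mkcond; apply: eq_bigr => i _.
    by rewrite mxE /toR map_row; case: ifP => // _; rewrite scale0r.
  move=> /ymin; rewrite toR_mul => /le_trans yle.
  rewrite -(ler_int R); apply: yle; rewrite mxE big1 // => i _.
  by rewrite !mxE; case: ifP => [/cI ->|_]; rewrite ?mulr0 ?mul0r.
(* The nonnegative terms of [y c] sum to 0, so [y] vanishes wherever [c] is positive. *)
have yJ i : ~ cone R B I (toR R (row i B)) -> y 0 i = 0.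
  move=> iJ; have [ci0 cJ] := cP i.
  have ci : c i 0 != 0 by apply/eqP => /cJ.
  have yc_ge0 k : true -> 0 <= y 0 k * c k 0.
    by move=> _; rewrite mulr_ge0 //; case: (cP k).
  have : (y *m c) 0 0 == 0 by rewrite eq_le yc0 mxE sumr_ge0.
  rewrite mxE psumr_eq0 // => /allP/(_ i (mem_index_enum i)) /=.
  by rewrite mulf_eq0 (negPf ci) orbF => /eqP.
exists (fun i => absz (y 0 i)).
have <- : y *m B = v.
  apply/rowP => j; apply: (@intr_inj R).
  by rewrite -toRE /toR map_mxM -[RHS]toRE -yv.
rewrite mulmx_sum_row [RHS]big_mkcond; apply: eq_bigr => i _.
case: asboolP => [_|/yJ ->]; last by rewrite scale0r.
by rewrite -scaler_nat natz gez0_abs.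
Qed.

End IntegralSystem.

Theorem theorem3p6 (R : realType) (m n : nat) (B : 'M[int]_(n, m)) :
  supernormal R B <-> (forall c : 'cV[int]_n, tight R B c -> TDI R B c).
Proof.
split=> [Bsn c|]; first exact: supernormal_tight_TDI.
exact: tight_TDI_supernormal.
Qed.
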